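(* For every integer $k\ge 1454$, $$f(k)\ge 1+\left\lfloor\frac{k-1454}{1665}\right\rfloor .$$ Moreover, $$\liminf_{k\to+\infty}\frac{f(k)}{k}\ge\frac1{1665}.$$ Here, for an integer $k\ge 1$, $f(k)$ denotes the maximal $m\in\{0,1,\ldots,k\}$ such that every orientation of the $k$-edge path with fewer than $m$ direction flips is tournament anti-Sidorenko.
   Context: An oriented graph $H=(V(H),E(H))$ has a finite vertex set and a set $E(H)\subseteq V(H)\times V(H)$ of directed edges, with no loops and at most one directed edge between each pair of distinct vertices. A tournament is an oriented complete graph (exactly one directed edge between each pair of distinct vertices); tournaments are finite and nonempty. A homomorphism from an oriented graph $H$ to a tournament $T$ is a map $g:V(H)\to V(T)$ such that $(g(u),g(v))\in E(T)$ for every $(u,v)\in E(H)$. The homomorphism density is $t(H,T)=\frac{|\mathrm{Hom}(H,T)|}{|V(T)|^{|V(H)|}}$, where $\mathrm{Hom}(H,T)$ is the set of homomorphisms. $H$ is tournament anti-Sidorenko if $t(H,T)\le (1/2)^{|E(H)|}$ for every tournament $T$. An orientation of the $k$-edge path is $P_k(\vec x)$ for some $\vec x=(x_1,\dots,x_k)\in\{-1,1\}^k$: its vertices are $v_0,\dots,v_k$, and for each $1\le i\le k$ it has the edge $(v_{i-1},v_i)$ if $x_i=1$ and the edge $(v_i,v_{i-1})$ if $x_i=-1$. A direction flip is an internal vertex $v_i$ ($1\le i\le k-1$) with $x_ix_{i+1}=-1$. *)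

(* Defs.v *)
From mathcomp Require Import all_boot all_order all_algebra.
From mathcomp Require Import boolp.

Set Implicit Arguments.
Unset Strict Implicit.
Unset Printing Implicit Defensive.

Import Order.TTheory GRing.Theory Num.Theory.
Local Open Scope ring_scope.

Record ograph := OGraph {
  vertex :> finType;
  edge : rel vertex;
  edge_irrefl : irreflexive edge;
  edge_asym : forall u v, u != v -> ~~ (edge u v && edge v u)
}.

Definition edges (H : ograph) : {set H * H} := [set p | edge p.1 p.2].

Definition is_tournament (T : ograph) : Prop :=
  (0 < #|vertex T|)%N /\ forall u v : T, u != v -> edge u v (+) edge v u.

Definition homs (H T : ograph) : {set {ffun H -> T}} :=
  [set g : {ffun H -> T} |
    [forall u, forall v, edge u v ==> edge (g u) (g v)]].

Definition hom_density (H T : ograph) : rat :=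
  #|homs H T|%:R / (#|vertex T| ^ #|vertex H|)%:R.

Definition anti_sidorenko (H : ograph) : Prop :=
  forall T : ograph, is_tournament T ->
    hom_density H T <= (1 / 2%:R) ^+ #|edges H|.

(* The sign vector (x_1, ..., x_k) is encoded by booleans indexed from 0:
   [x i = true] means x_(i+1) = 1 and [x i = false] means x_(i+1) = -1, so that
   [x i] orients the edge between v_i and v_(i+1). *)
Definition path_edge (k : nat) (x : {ffun 'I_k -> bool}) : rel 'I_k.+1 :=
  fun u v => [exists i : 'I_k,
    if x i then (u == i :> nat) && (v == i.+1 :> nat)
           else (u == i.+1 :> nat) && (v == i :> nat)].

Lemma path_edge_irrefl (k : nat) (x : {ffun 'I_k -> bool}) :
  irreflexive (path_edge x).
Proof.
move=> u; apply/existsP => -[i].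
by case: (x i) => /andP[/eqP-> /eqP/esym/eqP]; rewrite ?eqn_leq ?ltnn ?andbF.
Qed.

Lemma path_edge_asym (k : nat) (x : {ffun 'I_k -> bool}) (u v : 'I_k.+1) :
  u != v -> ~~ (path_edge x u v && path_edge x v u).
Proof.
move=> _; apply/negP => /andP[/existsP[i hi] /existsP[j hj]].
have E : i = j.
  apply/val_inj => /=; move: hi hj.
  case: (x i) => /andP[/eqP hu /eqP hv]; case: (x j) => /andP[/eqP hv' /eqP hu'].
  - have := leqnn i; rewrite -{1}hu hu' => h.
    have := leqnn j; rewrite -{1}hv' hv => h'.
    by have := ltn_trans h h'; rewrite ltnn.
  - by rewrite -hu -hu'.
  - by rewrite -hv -hv'.
  - have := leqnn i; rewrite -{1}hv hv' => h.
    have := leqnn j; rewrite -{1}hu' hu => h'.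
    by have := ltn_trans h h'; rewrite ltnn.
rewrite -{}E {j} in hj; move: hi hj.
by case: (x i) => /andP[/eqP hu /eqP hv] /andP[/eqP hv' /eqP];
  rewrite ?hu ?hv => /eqP; rewrite eqn_leq ltnn ?andbF.
Qed.

Definition path_graph (k : nat) (x : {ffun 'I_k -> bool}) : ograph :=
  OGraph (@path_edge_irrefl k x) (@path_edge_asym k x).

(* [v] is a flip when the edges v_(v-1) v_v and v_v v_(v+1) both exist (which
   forces [v] to be internal) and carry opposite signs. *)
Definition flips (k : nat) (x : {ffun 'I_k -> bool}) : {set 'I_k.+1} :=
  [set v : 'I_k.+1 | [exists i : 'I_k, exists j : 'I_k,
    [&& i.+1 == v :> nat, j == v :> nat & x i != x j]]].

Definition few_flips_anti_sidorenko (k m : nat) : Prop :=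
  forall x : {ffun 'I_k -> bool},
    (#|flips x| < m)%N -> anti_sidorenko (path_graph x).

(* [m = 0] always satisfies the condition vacuously, so the value 0 of an empty
   [\max] plays no role. *)
Definition f (k : nat) : nat :=
  \max_(m < k.+1 | `[< few_flips_anti_sidorenko k m >]) m.

(* Main.v *)
Require Import Defs.
From mathcomp Require Import all_boot all_order all_algebra.
From mathcomp Require Import all_classical all_reals all_analysis.
From mathcomp Require Import ring lra zify.

(** A path with few direction flips, counted as a product of perturbed
projections.  Let [T] be a tournament on [n] vertices, [e] the constant
function 1 on its vertices, and [S] the skew kernel with value 1 or -1 on each
pair according to the direction of its edge.  In the scalar product normalised
by [n], so that [e] is a unit vector, a step along an edge of the path acts on
functions as half of [n] times [v |-> <e,v> e + S v] or
[v |-> <e,v> e - S v], depending on the orientation; the loops that this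
operator adds with weight 1/2 can only increase the count.  So the path is
anti-Sidorenko as soon as the product of these operators, applied to [e], has
mean at most 1.

Everything is measured by the variance [a = |S e|^2] of the scores, which is at
most 1/3 ([score_variance_le]).  The quadratic form
[energy S v = |v|^2 - 2 <e,v> <S e,v>] is a Lyapunov function: a step of sign
[S] multiplies it by at most [1 - a/8] ([energy_straight]), and a step of sign
[S] raises [energy S] to at most [1 + 31 a] times the previous value of
[energy (-S)] ([energy_flip]).  Both are statements about five real numbers
(the coordinates of [v] and [S v] relative to [e] and [S e]), constrained by
Cauchy-Schwarz and by the bound [1/2] on the squared norm of a skew kernel
([skew_norm_le]); the coefficient 2 in the energy is the one for which
a straight step multiplies both [<e,v>^2] and the mixed term by [1 - a].

Since [energy S e = 1] and [energy S v >= (1 - a) <e,v>^2]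
([energy_ge]), the square of the mean after [k] steps with [l] flips is at most
[(1 + 31 a)^l (1 - a/8)^(k - l) / (1 - a)].  By Bernoulli's inequality 248
straight steps compensate a flip, whatever [a] is, and 12 more compensate the
denominator.  Hence [k >= 249 l + 12] suffices ([path_anti_sidorenko]), that is
[f k >= 1 + (k - 12) %/ 249], from which both claims follow. *)

Set Implicit Arguments.
Unset Strict Implicit.
Unset Printing Implicit Defensive.

Import Order.TTheory GRing.Theory Num.Theory.
Local Open Scope ring_scope.

(** * Real inequalities behind one step and behind the final balance *)

Section Scalars.
Variables (F : realFieldType).
Implicit Types a c p q U W : F.

(** In the next three lemmas [c], [p], [q], [U], [W] stand for [<e,v>], [<s,w>],
[<s,Sw>], [|Sw|^2], [|w|^2], where [s = S e] and [w] is the component of [v]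
orthogonal to [e].  Here the product [4 p^2 (U - p^2)] is at most [U^2], so the
cross term is at most [sqrt a * U]; the rational 3/5 exceeds [sqrt (1/3)]. *)
Lemma cross_term_le a p q U W : 0 <= a <= 1 / 3 -> 0 <= U -> U <= W / 2 ->
  q ^+ 2 <= a * (U - p ^+ 2) -> `|2 * p * q| <= 4 / 5 * W - U.
Proof.
move=> /andP[a0 a1] U0 UW qU.
have h : `|2 * p * q| <= 3 / 5 * U.
  rewrite -(ler_pXn2r (n := 2)) ?nnegrE//; last by rewrite mulr_ge0//; lra.
  rewrite -normrX ger0_norm ?sqr_ge0//.
  have -> : (2 * p * q) ^+ 2 = 4 * p ^+ 2 * q ^+ 2 by ring.
  have p0 := sqr_ge0 p.
  have h1 := ler_wpM2l (mulr_ge0 (ler0n F 4) p0) qU.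
  apply: (le_trans h1).
  have := sqr_ge0 (U - 2 * p ^+ 2); set P := p ^+ 2 in p0 *.
  have := sqr_ge0 U.
  rewrite !expr2 => h2 h3.
  have h4 : 4 * P * (U - P) <= U * U by nra.
  have h5 : a * (4 * P * (U - P)) <= a * (U * U) by apply: ler_wpM2l.
  nra.
lra.
Qed.

(** The terms in [c] on the left have coefficient [1 - a] and exactly the shape
[c^2 - 2cp] of those on the right, so what remains to beat is
[c^2 - 2cp >= - p^2], of order [a W], against the fixed proportion of [W] that
is lost because [U + 2pq <= 4W/5]. *)
Lemma straight_step_scalar a c p q U W : 0 <= a <= 1 / 3 -> 0 <= U ->
  U <= W / 2 -> p ^+ 2 <= a * W -> q ^+ 2 <= a * (U - p ^+ 2) ->
  (1 - a) * (c ^+ 2 - 2 * c * p) + U + 2 * p * q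
    <= (1 - a / 8) * (c ^+ 2 - 2 * c * p + W).
Proof.
move=> ha U0 UW pW qU; have := cross_term_le ha U0 UW qU.
case/andP: ha => a0 a1; rewrite ler_norml => /andP[_ pq].
have W0 : 0 <= W by lra.
have h1 : - (a * W) <= c ^+ 2 - 2 * c * p.
  have := sqr_ge0 (c - p); nra.
have h2 : a * - (a * W) <= a * (c ^+ 2 - 2 * c * p) by apply: ler_wpM2l.
have h3 : a * W <= 1 / 3 * W by apply: ler_wpM2r.
have h4 : a * (a * W) <= 1 / 3 * (a * W) by apply: ler_wpM2r; rewrite ?mulr_ge0.
nra.
Qed.

(** Here the terms in [cp] add up instead of cancelling.  They are absorbed by
the extra [32 a c^2] and by the slack [W/5], because [p^2 <= a W]: the
discriminant of the resulting quadratic polynomial in [c] is nonpositive. *)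
Lemma flip_step_scalar a c p q U W : 0 <= a <= 1 / 3 -> 0 <= U ->
  U <= W / 2 -> p ^+ 2 <= a * W -> q ^+ 2 <= a * (U - p ^+ 2) ->
  (1 - a) * (c ^+ 2 - 2 * c * p) + U + 2 * p * q
    <= (1 + 31 * a) * (c ^+ 2 + 2 * c * p + W).
Proof.
move=> ha U0 UW pW qU; have := cross_term_le ha U0 UW qU.
case/andP: ha => a0 a1; rewrite ler_norml => /andP[_ pq].
have W0 : 0 <= W by lra.
suff : 0 <= 32 * a * c ^+ 2 + 2 * c * p * (2 + 30 * a) + (1 / 5 + 31 * a) * W.
  by nra.
have [a_eq0|a_neq0] := eqVneq a 0.
  rewrite a_eq0 mul0r in pW.
  have -> : p = 0 by apply/eqP; rewrite -sqrf_eq0 eq_le pW sqr_ge0.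
  by rewrite a_eq0; lra.
have a_gt0 : 0 < a by rewrite lt_def a_neq0.
(* Complete the square in [c] after multiplying by the leading coefficient. *)
rewrite -(pmulr_rge0 _ (_ : 0 < 32 * a)); last by rewrite mulr_gt0.
have sq := sqr_ge0 (32 * a * c + (2 + 30 * a) * p).
have h1 : (2 + 30 * a) ^+ 2 * p ^+ 2 <= (2 + 30 * a) ^+ 2 * (a * W).
  by apply: ler_wpM2l; rewrite ?sqr_ge0.
have h2 : (2 + 30 * a) ^+ 2 * (a * W) <= 32 * (1 / 5 + 31 * a) * (a * W).
  apply: ler_wpM2r; first by rewrite mulr_ge0.
  by nra.
nra.
Qed.

Lemma bernoulli_inv (a : F) n : 0 <= a <= 1 -> (1 - a) ^+ n * (1 + n%:R * a) <= 1.
Proof.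
case/andP=> a0 a1; elim: n => [|n IH]; first by rewrite expr0 mul0r addr0 mul1r.
apply: le_trans IH; rewrite exprSr -mulrA.
apply: ler_wpM2l; first by rewrite exprn_ge0// subr_ge0.
rewrite -natr1; have := ler0n F n; nra.
Qed.

(** The product [n * a] is a separate argument so that large numerals [n] are
never unified with each other. *)
Lemma bernoulli_invM (a b : F) n : 0 <= a <= 1 -> b = n%:R * a ->
  (1 - a) ^+ n * (1 + b) <= 1.
Proof. by move=> ha ->; exact: bernoulli_inv. Qed.

(** Each factor [y] is paid for by [N] factors [x], and [M] further factors
bring the product below [z]. *)
Lemma pow_balance (x y z : F) N M l m : 0 <= x <= 1 -> 0 <= y ->
  x ^+ N * y <= 1 -> x ^+ M <= z -> (N * l + M <= m)%N ->
  y ^+ l * x ^+ m <= z.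
Proof.
move=> /andP[x0 x1] y0 hN hM lm.
apply: (@le_trans _ _ (y ^+ l * x ^+ (N * l + M))).
  by apply: ler_wpM2l; [exact: exprn_ge0 | apply: ler_wiXn2l].
rewrite exprD exprM mulrA -exprMn mulrC -[leRHS]mulr1.
apply: ler_pM => //; first exact: exprn_ge0.
  by rewrite exprn_ge0// mulr_ge0// exprn_ge0.
by rewrite exprn_ile1// 1?mulrC// mulr_ge0// exprn_ge0.
Qed.

(** Bernoulli's inequality with [248 / 8 = 31] for the flips, and with
[12 / 8 = 3/2] for the last factor, since [(1 - a)(1 + 3a/2) >= 1] exactly when
[0 <= a <= 1/3]. *)
Lemma growth_bound (a : F) l m : 0 <= a <= 1 / 3 -> (248 * l + 12 <= m)%N ->
  (1 + 31 * a) ^+ l * (1 - a / 8) ^+ m <= 1 - a.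
Proof.
move=> /andP[a0 a1].
have a8 : 0 <= a / 8 <= 1 by lra.
apply: pow_balance; [lra | lra | |].
  by apply: bernoulli_invM; [exact: a8 | lra].
have h : (1 - a / 8) ^+ 12 * (1 + 3 / 2 * a) <= 1.
  by apply: bernoulli_invM; [exact: a8 | lra].
have h2 : 1 <= (1 - a) * (1 + 3 / 2 * a) by nra.
by rewrite -(ler_pM2r (_ : 0 < 1 + 3 / 2 * a)) ?(le_trans h h2)//; lra.
Qed.
End Scalars.

(** * Skew kernels as operators *)

(** Lagrange's identity: the defect is half of the sum of the squares
[(x i * y j - x j * y i) ^+ 2]. *)
Lemma cauchy_schwarz_sum (F : realFieldType) (I : finType) (x y : I -> F) :
  (\sum_i x i * y i) ^+ 2 <= (\sum_i x i ^+ 2) * (\sum_i y i ^+ 2).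
Proof.
have : 0 <= \sum_i \sum_j (x i * y j - x j * y i) ^+ 2.
  by apply: sumr_ge0 => i _; apply: sumr_ge0 => j _; exact: sqr_ge0.
under eq_bigr => i _.
  under eq_bigr => j _.
    have -> : (x i * y j - x j * y i) ^+ 2 = x i ^+ 2 * y j ^+ 2
        + y i ^+ 2 * x j ^+ 2 + (- 2 * (x i * y i)) * (x j * y j) by ring.
  over.
  rewrite !big_split /= -!mulr_sumr.
over.
rewrite !big_split /= -!mulr_suml -mulr_sumr.
by set A := \sum_i x i ^+ 2; set B := \sum_i y i ^+ 2; set C := \sum_i _; lra.
Qed.

Section Operators.
Variables (F : realFieldType) (V : finType).
Hypothesis V_gt0 : (0 < #|V|)%N.
Implicit Types (u v w : {ffun V -> F}) (S : V -> V -> F).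

Definition dot u v : F := (\sum_i u i * v i) / #|V|%:R.
Definition kernel_op S v : {ffun V -> F} :=
  [ffun i => (\sum_j S i j * v j) / #|V|%:R].
Definition axpy c u v : {ffun V -> F} := [ffun i => c * u i + v i].
Definition ones : {ffun V -> F} := [ffun=> 1].

Definition skew_kernel S :=
  (forall i j, S i j = - S j i) /\ (forall i j, -1 <= S i j <= 1).

Let n : F := #|V|%:R.
Let n_gt0 : 0 < n. Proof. by rewrite ltr0n. Qed.
Let n_neq0 : n != 0. Proof. by rewrite gt_eqF. Qed.

Lemma dotC u v : dot u v = dot v u.
Proof. by rewrite /dot; congr (_ / _); apply: eq_bigr => i _; rewrite mulrC. Qed.

Lemma dot_axpyr w c u v : dot w (axpy c u v) = c * dot w u + dot w v.
Proof.
rewrite /dot mulrA -mulrDl mulr_sumr -big_split /=; congr (_ / _).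
by apply: eq_bigr => i _; rewrite ffunE mulrDr mulrCA.
Qed.

Lemma dot_axpyl w c u v : dot (axpy c u v) w = c * dot u w + dot v w.
Proof. by rewrite dotC dot_axpyr !(dotC w). Qed.

Lemma dot_ge0 u : 0 <= dot u u.
Proof. by rewrite divr_ge0 ?ler0n// sumr_ge0// => i _; rewrite -expr2 sqr_ge0. Qed.

Lemma dot_ones : dot ones ones = 1.
Proof.
rewrite /dot (eq_bigr (fun=> 1)) => [|i _]; last by rewrite !ffunE mulr1.
by rewrite sumr_const cardT -cardE divff.
Qed.

Lemma dot_cauchy_schwarz u v : dot u v ^+ 2 <= dot u u * dot v v.
Proof.
rewrite /dot expr_div_n mulf_div -expr2 ler_pM2r ?invr_gt0 ?exprn_gt0//.
have := cauchy_schwarz_sum u v.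
by under [in X in _ <= X]eq_bigr do rewrite expr2;
   under [X in _ <= _ * X]eq_bigr do rewrite expr2.
Qed.

Lemma kernel_op_axpy S c u v :
  kernel_op S (axpy c u v) = axpy c (kernel_op S u) (kernel_op S v).
Proof.
apply/ffunP => i; rewrite !ffunE mulrA -mulrDl mulr_sumr -big_split /=.
by congr (_ / _); apply: eq_bigr => j _; rewrite !ffunE mulrDr mulrCA.
Qed.

Lemma sum_dot u v : \sum_i u i * v i = n * dot u v.
Proof. by rewrite mulrCA divff ?mulr1. Qed.

Lemma sum_kernel_op S u v :
  \sum_i \sum_j S i j * (u i * v j) = n ^+ 2 * dot u (kernel_op S v).
Proof.
rewrite expr2 -mulrA -sum_dot mulr_sumr; apply: eq_bigr => i _.
rewrite ffunE mulrCA [n * _]mulrC divfK// mulr_sumr.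
by apply: eq_bigr => j _; rewrite mulrCA.
Qed.

Section Skew.
Variable S : V -> V -> F.
Hypothesis skewS : skew_kernel S.

Lemma dot_kernel_op_skew u v : dot u (kernel_op S v) = - dot (kernel_op S u) v.
Proof.
apply: (mulfI (_ : n ^+ 2 != 0)); first by rewrite expf_neq0.
rewrite -sum_kernel_op mulrN dotC -sum_kernel_op exchange_big -sumrN.
apply: eq_bigr => i _ /=; rewrite -sumrN; apply: eq_bigr => j _.
by rewrite (skewS.1 j i) mulNr (mulrC (u _)).
Qed.

Lemma dot_kernel_op_diag u : dot u (kernel_op S u) = 0.
Proof. by have := dot_kernel_op_skew u u; rewrite [dot (kernel_op S u) u]dotC; lra. Qed.

(** The singular values of a skew operator come in equal pairs, so the squared
norm is at most half of the squared Hilbert-Schmidt norm, which is at most 1.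
Without singular values: for [u = S w], which is orthogonal to [w], pair [S]
with the alternating tensor of [u] and [w] and apply Cauchy-Schwarz over pairs of
vertices. *)
Lemma skew_norm_le w : dot (kernel_op S w) (kernel_op S w) <= dot w w / 2.
Proof.
set u := kernel_op S w; set U := dot u u; set W := dot w w.
have U0 : 0 <= U := dot_ge0 u.
have W0 : 0 <= W := dot_ge0 w.
have uw : dot u w = 0 by rewrite dotC dot_kernel_op_diag.
pose z (q : V * V) := u q.1 * w q.2 - w q.1 * u q.2.
have Sz : \sum_q S q.1 q.2 * z q = n ^+ 2 * (2 * U).
  rewrite -(pair_bigA _ (fun i j => S i j * (u i * w j - w i * u j))) /=.
  under eq_bigr => i _.
    under eq_bigr => j _ do rewrite mulrBr.
    rewrite big_split /= sumrN.
  over.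
  by rewrite big_split sumrN /= !sum_kernel_op (dot_kernel_op_skew w) -/u -/U; ring.
have SS : \sum_q S q.1 q.2 ^+ 2 <= n ^+ 2.
  apply: (@le_trans _ _ (\sum_(q : V * V) 1)).
    apply: ler_sum => q _; have := skewS.2 q.1 q.2; nra.
  by rewrite sumr_const card_prod natrM expr2.
have zz : \sum_q z q ^+ 2 = n ^+ 2 * (2 * U * W).
  rewrite -(pair_bigA _ (fun i j => (u i * w j - w i * u j) ^+ 2)) /=.
  under eq_bigr => i _.
    under eq_bigr => j _.
      have -> : (u i * w j - w i * u j) ^+ 2 = (u i * u i) * (w j * w j)
        + (w i * w i) * (u j * u j) + (- 2 * (u i * w i)) * (u j * w j) by ring.
    over.
    rewrite !big_split /= -!mulr_sumr.
  over.
  rewrite !big_split /= -!mulr_suml -mulr_sumr !sum_dot uw -/U -/W; ring.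
have := cauchy_schwarz_sum (fun q : V * V => S q.1 q.2) z.
rewrite Sz zz => cs.
have {cs} : (n ^+ 2 * (2 * U)) ^+ 2 <= n ^+ 2 * (n ^+ 2 * (2 * U * W)).
  apply: (le_trans cs); apply: ler_wpM2r => //.
  by apply: mulr_ge0; [exact: sqr_ge0 | apply: mulr_ge0 => //; lra].
have -> : (n ^+ 2 * (2 * U)) ^+ 2 = n ^+ 2 * (n ^+ 2 * (4 * U * U)) by ring.
rewrite !ler_pM2l ?exprn_gt0// => h.
have [U_gt0|] := ltP 0 U; last by lra.
rewrite -(ler_pM2l U_gt0); lra.
Qed.

(** Averaged over triples: with [a], [b], [c] the values of the kernel around a
triangle, the three products of consecutive values satisfy
[- (ab + bc + ca) <= 1], as [(1 + a)(1 + b)(1 + c) + (1 - a)(1 - b)(1 - c) >= 0]. *)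
Lemma score_variance_le : dot (kernel_op S ones) (kernel_op S ones) <= 1 / 3.
Proof.
pose t i j k := S i j * S i k.
have tE : \sum_i \sum_j \sum_k t i j k
    = n ^+ 3 * dot (kernel_op S ones) (kernel_op S ones).
  rewrite exprSr -mulrA -sum_dot mulr_sumr.
  apply: eq_bigr => i _; rewrite !ffunE -/n.
  transitivity ((\sum_j S i j) * (\sum_k S i k)).
    rewrite mulr_suml; apply: eq_bigr => j _.
    by rewrite mulr_sumr.
  under [in RHS]eq_bigr do rewrite ffunE mulr1.
  by field.
have tE2 : \sum_i \sum_j \sum_k t j k i = \sum_i \sum_j \sum_k t i j k.
  rewrite exchange_big; apply: eq_bigr => i _ /=.
  by rewrite exchange_big.
have tE3 : \sum_i \sum_j \sum_k t k i j = \sum_i \sum_j \sum_k t i j k.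
  rewrite -tE2 exchange_big; apply: eq_bigr => i _ /=.
  by rewrite exchange_big; apply: eq_bigr => j _.
have : \sum_i \sum_j \sum_k (t i j k + t j k i + t k i j)
    <= \sum_(i : V) \sum_(j : V) \sum_(k : V) 1.
  apply: ler_sum => i _; apply: ler_sum => j _; apply: ler_sum => k _.
  rewrite /t (skewS.1 i k) (skewS.1 j i) (skewS.1 k j).
  have /andP[a0 a1] := skewS.2 i j; have /andP[b0 b1] := skewS.2 j k.
  have /andP[c0 c1] := skewS.2 k i.
  set a := S i j in a0 a1 *; set b := S j k in b0 b1 *; set c := S k i in c0 c1 *.
  have h1 : 0 <= (1 + a) * (1 + b) * (1 + c) by rewrite !mulr_ge0//; lra.
  have h2 : 0 <= (1 - a) * (1 - b) * (1 - c) by rewrite !mulr_ge0//; lra.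
  lra.
do 2![under eq_bigr do under eq_bigr do rewrite big_split /=;
      under eq_bigr do rewrite big_split /=; rewrite big_split /=].
rewrite tE tE2 tE3.
have sumC (c : F) : \sum_(i : V) c = n * c by rewrite sumr_const mulr_natl.
rewrite !sumC => h.
rewrite -(ler_pM2l (exprn_gt0 3 n_gt0)).
have -> : n ^+ 3 * (1 / 3) = n * (n * (n * 1)) / 3 by field.
lra.
Qed.

(** One edge of the path, up to the factor [n / 2]: the averaging projection onto
constants plus the skew part. *)
Definition step v := axpy (dot ones v) ones (kernel_op S v).
Definition energy v := dot v v - 2 * dot ones v * dot (kernel_op S ones) v.

(** The passage from vectors to scalars.  The three energies are those of [v] for
[S], of [v] for the opposite kernel, and of the image of [v]. *)
Lemma step_coordinates v : let a := dot (kernel_op S ones) (kernel_op S ones) in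
  exists c p q U W, [/\ 0 <= U, U <= W / 2, p ^+ 2 <= a * W,
    q ^+ 2 <= a * (U - p ^+ 2) &
  [/\ energy v = c ^+ 2 - 2 * c * p + W,
    dot v v + 2 * dot ones v * dot (kernel_op S ones) v = c ^+ 2 + 2 * c * p + W &
    energy (step v) = (1 - a) * (c ^+ 2 - 2 * c * p) + U + 2 * p * q]].
Proof.
move=> a; set s := kernel_op S ones; set c := dot ones v.
have [w vE] : exists w, v = axpy c ones w.
  by exists (axpy (- c) ones v); apply/ffunP => i; rewrite !ffunE; ring.
have os : dot ones s = 0 by rewrite dot_kernel_op_diag.
have so : dot s ones = 0 by rewrite dotC.
have ow : dot ones w = 0.
  by have := congr1 (dot ones) vE; rewrite dot_axpyr dot_ones -/c; lra.
have wo : dot w ones = 0 by rewrite dotC.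
pose u := kernel_op S w.
have ou : dot ones u = - dot s w by rewrite dot_kernel_op_skew.
have uo : dot u ones = - dot s w by rewrite dotC.
exists c, (dot s w), (dot s u), (dot u u), (dot w w); split; last split.
- exact: dot_ge0.
- exact: skew_norm_le.
- exact: dot_cauchy_schwarz.
- have := dot_cauchy_schwarz s (axpy (dot s w) ones u).
  rewrite !dot_axpyr !dot_axpyl dot_ones so ou uo -/a.
  by congr (_ <= _); ring.
- rewrite /energy -/s -/c {1 2 3}vE !dot_axpyr !dot_axpyl dot_ones so ow wo.
  ring.
- rewrite -/s {1 2 3}vE !dot_axpyr !dot_axpyl dot_ones so ow wo -/c.
  ring.
- rewrite /energy /step -/s -/c {1 2 3 4}vE kernel_op_axpy -/s -/u.
  rewrite !(dot_axpyr, dot_axpyl) dot_ones so os ou uo (dotC u s) -/a.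
  ring.
Qed.
End Skew.
End Operators.

(** * The Lyapunov function along an oriented path *)

Section Lyapunov.
Variables (F : realFieldType) (V : finType).
Hypothesis V_gt0 : (0 < #|V|)%N.
Implicit Types (u v w : {ffun V -> F}) (S : V -> V -> F).

Definition signed (b : bool) S i j := if b then S i j else - S i j.

Lemma signed_skew b S : skew_kernel S -> skew_kernel (signed b S).
Proof.
case=> sk bd; case: b; split=> //= i j; first by rewrite sk.
by have := bd i j; lra.
Qed.

Lemma kernel_op_oppE S v i : kernel_op (fun i j => - S i j) v i = - kernel_op S v i.
Proof.
rewrite !ffunE -mulNr -sumrN; congr (_ / _).
by apply: eq_bigr => j _; rewrite mulNr.
Qed.

Lemma dot_kernel_op_oppr S u v :
  dot (kernel_op (fun i j => - S i j) u) v = - dot (kernel_op S u) v.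
Proof.
rewrite /dot -mulNr -sumrN; congr (_ / _).
by apply: eq_bigr => i _; rewrite kernel_op_oppE mulNr.
Qed.

Definition score_variance S := dot (kernel_op S (ones F V)) (kernel_op S (ones F V)).

Lemma score_variance_signed b S : score_variance (signed b S) = score_variance S.
Proof.
case: b => //; rewrite /score_variance /signed dot_kernel_op_oppr dotC.
by rewrite dot_kernel_op_oppr opprK.
Qed.

Lemma energy_opp S v : energy (fun i j => - S i j) v
  = dot v v + 2 * dot (ones F V) v * dot (kernel_op S (ones F V)) v.
Proof. by rewrite /energy dot_kernel_op_oppr; ring. Qed.

Lemma score_variance_bounds S : skew_kernel S -> 0 <= score_variance S <= 1 / 3.
Proof. by move=> skS; rewrite score_variance_le// dot_ge0. Qed.

Lemma energy_straight S v : skew_kernel S ->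
  energy S (step S v) <= (1 - score_variance S / 8) * energy S v.
Proof.
move=> skS; have [c [p [q [U [W [U0 UW pW qU [-> _ ->]]]]]]] :=
  step_coordinates V_gt0 skS v.
by apply: straight_step_scalar => //; exact: score_variance_bounds.
Qed.

Lemma energy_flip S v : skew_kernel S ->
  energy S (step S v) <= (1 + 31 * score_variance S) * energy (fun i j => - S i j) v.
Proof.
move=> skS; have [c [p [q [U [W [U0 UW pW qU [_ eN ->]]]]]]] :=
  step_coordinates V_gt0 skS v.
rewrite energy_opp eN.
by apply: flip_step_scalar => //; exact: score_variance_bounds.
Qed.

Lemma energy_ones S : skew_kernel S -> energy S (ones F V) = 1.
Proof.
by move=> skS; rewrite /energy dot_ones// dotC dot_kernel_op_diag// mulr0 subr0.
Qed.

(** With [c = <e,v>] and [s = S e] orthogonal to [e], the vector [v - c s] still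
has mean [c], hence [|v - c s|^2 >= c^2]; and its squared norm is
[energy S v + a c^2]. *)
Lemma energy_ge S v : skew_kernel S ->
  (1 - score_variance S) * dot (ones F V) v ^+ 2 <= energy S v.
Proof.
move=> skS; set c := dot _ v; set s := kernel_op S (ones F V).
have := dot_cauchy_schwarz V_gt0 (ones F V) (axpy (- c) s v).
rewrite dot_ones// !dot_axpyr !dot_axpyl dot_kernel_op_diag//.
rewrite /energy /score_variance -/s -/c (dotC v s); nra.
Qed.

Fixpoint path_vector S (X : nat -> bool) k : {ffun V -> F} :=
  if k is j.+1 then step (signed (X j) S) (path_vector S X j) else ones F V.

Definition changes (X : nat -> bool) k : nat := \sum_(i < k) (X i != X i.+1).

Lemma changes_le X k : (changes X k <= k)%N.
Proof.
rewrite -[leqRHS]card_ord -sum1_card; apply: leq_sum => i _.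
by case: eqP.
Qed.

(** The energy that decreases is the one whose sign is that of the last step, so
the bound follows the sign along the path; the first step counts as straight
because all energies of [e] are 1. *)
Lemma energy_path_vector S X k : skew_kernel S ->
  energy (signed (X k) S) (path_vector S X k.+1)
    <= (1 + 31 * score_variance S) ^+ changes X k
       * (1 - score_variance S / 8) ^+ (k.+1 - changes X k).
Proof.
move=> skS; have /andP[] := score_variance_bounds skS.
set a := score_variance S => a0 a1.
elim: k => [|k IH].
  rewrite /changes big_ord0 subn0 mul1r expr1 /=.
  have := energy_straight (ones F V) (signed_skew (X 0) skS).
  by rewrite energy_ones ?score_variance_signed ?mulr1//; exact: signed_skew.
have skX := signed_skew (X k.+1) skS.
have -> : changes X k.+1 = (changes X k + (X k != X k.+1))%N.
  by rewrite /changes big_ord_recr.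
rewrite [path_vector _ _ k.+2]/=; set v := path_vector S X k.+1 in IH *.
have [XE|XE] := eqVneq (X k) (X k.+1).
  rewrite addn0 subSn ?(leq_trans (changes_le X k))// exprS mulrCA.
  apply: le_trans (energy_straight v skX) _.
  rewrite score_variance_signed -/a -XE; apply: ler_wpM2l => //; lra.
rewrite addn1 subSS exprS -mulrA.
apply: le_trans (energy_flip v skX) _.
rewrite score_variance_signed -/a; apply: ler_wpM2l; first by lra.
suff -> : energy (fun i j => - signed (X k.+1) S i j) v
    = energy (signed (X k) S) v by [].
move: XE; rewrite energy_opp; case: (X k); case: (X k.+1) => // _.
- by rewrite /energy /signed dot_kernel_op_oppr; ring.
- by rewrite -energy_opp.
Qed.

Lemma mean_path_vector_le1 S X k : skew_kernel S ->
  (249 * changes X k + 12 <= k.+1)%N -> dot (ones F V) (path_vector S X k.+1) <= 1.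
Proof.
move=> skS hk; set v := path_vector _ _ _.
have ha := score_variance_bounds skS; have /andP[a0 a1] := ha.
have hm : (248 * changes X k + 12 <= k.+1 - changes X k)%N.
  by rewrite leq_subRL ?(leq_trans (changes_le X k))// addnA -mulSn.
have h1 := growth_bound ha hm.
have h2 := energy_path_vector X k skS.
have h3 := energy_ge v (signed_skew (X k) skS).
rewrite score_variance_signed in h3.
have h := le_trans h3 (le_trans h2 h1).
rewrite -[leRHS]mulr1 ler_pM2l in h; last by lra.
by have := sqr_ge0 (dot (ones F V) v - 1); nra.
Qed.
End Lyapunov.

(** * Weighted walks *)

Section Walks.
Variables (F : realFieldType) (V : finType).

Fixpoint walk (K : nat -> V -> V -> F) k (b : V) : F :=
  if k is j.+1 then \sum_a walk K j a * K j a b else 1.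

(** Walks are enumerated by their last vertex, so functions on [k.+2] points are
split at [ord_max]. *)
Definition extend k (p : {ffun 'I_k.+1 -> V} * V) : {ffun 'I_k.+2 -> V} :=
  [ffun i => if unlift ord_max i is Some j then p.1 j else p.2].

Lemma extend_lift k p (j : 'I_k.+1) : extend p (lift ord_max j) = p.1 j.
Proof. by rewrite ffunE liftK. Qed.

Lemma extend_max k (p : {ffun 'I_k.+1 -> V} * V) : extend p ord_max = p.2.
Proof. by rewrite ffunE unlift_none. Qed.

Lemma extend_bij k : bijective (@extend k).
Proof.
pose restrict (g : {ffun 'I_k.+2 -> V}) :=
  ([ffun j : 'I_k.+1 => g (lift ord_max j)], g ord_max).
exists restrict => [[g b]|g].
  rewrite /restrict extend_max /=; congr pair; apply/ffunP => j.
  by rewrite ffunE extend_lift.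
apply/ffunP => i; rewrite ffunE; case: unliftP => [j|] -> //=.
by rewrite ffunE.
Qed.

(** Transfer-matrix formula.  The weight [h] of the endpoint makes the statement
strong enough for the induction: a new last edge is absorbed into [h]. *)
Lemma sum_paths (K : nat -> V -> V -> F) k (h : V -> F) :
  \sum_(g : {ffun 'I_k.+1 -> V})
    (\prod_(i < k) K i (g (widen_ord (leqnSn k) i)) (g (lift ord0 i))) * h (g ord_max)
  = \sum_b walk K k b * h b.
Proof.
elim: k h => [|k IH] h.
  rewrite (reindex (fun b : V => [ffun=> b])) /=; last first.
    exists (fun g => g ord0) => [b _|g _]; first by rewrite ffunE.
    by apply/ffunP => i; rewrite ffunE (ord1 i).
  by apply: eq_bigr => b _; rewrite big_ord0 ffunE.
rewrite (reindex (@extend k)) /=; last exact/onW_bij/extend_bij.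
transitivity (\sum_(g : {ffun 'I_k.+1 -> V})
    (\prod_(i < k) K i (g (widen_ord (leqnSn k) i)) (g (lift ord0 i)))
     * \sum_b K k (g ord_max) b * h b).
  under [RHS]eq_bigr do rewrite mulr_sumr.
  rewrite pair_bigA /=; apply: eq_bigr => -[g b] _ /=.
  rewrite big_ord_recr extend_max /= -mulrA; congr (_ * (K k _ _ * _)).
  - apply: eq_bigr => i _; congr (K i _ _).
      rewrite -(extend_lift (g, b)); congr (extend _ _); apply/val_inj.
      by rewrite [RHS]lift_max.
    rewrite -(extend_lift (g, b)); congr (extend _ _); apply/val_inj.
    by rewrite [RHS]lift_max.
  - rewrite -(extend_lift (g, b)); congr (extend _ _); apply/val_inj.
    by rewrite [RHS]lift_max.
  - by rewrite -[RHS](extend_max (g, b)); congr (extend _ _); apply/val_inj.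
rewrite (IH (fun a => \sum_b K k a b * h b)) /=.
under eq_bigr do rewrite mulr_sumr.
rewrite exchange_big; apply: eq_bigr => b _ /=.
by rewrite mulr_suml; apply: eq_bigr => a _; rewrite mulrA.
Qed.

Lemma walk_half_signed (S : V -> V -> F) X k b : (0 < #|V|)%N ->
  walk (fun i a b => (1 + signed (X i) S b a) / 2) k b
    = (#|V|%:R / 2) ^+ k * path_vector S X k b.
Proof.
move=> V0; have n0 : #|V|%:R != 0 :> F by rewrite pnatr_eq0 -lt0n.
elim: k b => [|k IH] b; first by rewrite expr0 mul1r ffunE.
rewrite /= !ffunE exprS -mulrA mulrCA.
under eq_bigr do rewrite IH -mulrA.
rewrite -mulr_sumr; congr (_ * _); set v := path_vector _ _ _.
have -> : #|V|%:R / 2 * (dot (ones F V) v * 1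
    + (\sum_j signed (X k) S b j * v j) / #|V|%:R)
  = (\sum_i 1 * v i + \sum_j signed (X k) S b j * v j) / 2.
  rewrite /dot; under [in LHS]eq_bigr do rewrite ffunE.
  by field.
rewrite -big_split mulr_suml /=; apply: eq_bigr => i _.
by rewrite -mulrDl; ring.
Qed.
End Walks.

(** * Homomorphisms from oriented paths to tournaments *)

(** In-degree sign convention: [walk] sums over the source [a] of a step from [a]
to [b], whereas an operator kernel is indexed by the target first. *)
Definition tournament_kernel (T : ograph) (i j : T) : rat :=
  (edge j i)%:R - (edge i j)%:R.

Lemma tournament_kernel_skew (T : ograph) : skew_kernel (@tournament_kernel T).
Proof.
split=> i j; rewrite /tournament_kernel; first by rewrite opprB.
by do 2!case: edge.
Qed.

Lemma signed_kernel_edge (T : ograph) (x : bool) (i j : T) :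
  (if x then edge i j else edge j i) ->
  signed x (@tournament_kernel T) j i = 1.
Proof.
rewrite /signed /tournament_kernel.
have asym (u v : T) : edge u v -> edge v u = false.
  move=> uv; apply/negbTE.
  have: u != v by apply: contraTneq uv => ->; rewrite edge_irrefl.
  by move/edge_asym; rewrite uv.
by case: x => e; rewrite e (asym _ _ e).
Qed.

(** Each factor [(1 + S) / 2] is nonnegative everywhere and equals 1 on the edges
of the tournament that have the required orientation, so the weighted number of
walks dominates the number of homomorphisms. *)
Lemma card_homs_path_le k (x : {ffun 'I_k.+1 -> bool}) (T : ograph) :
  (0 < #|T|)%N ->
  (#|homs (path_graph x) T|%:R : rat)
    <= (#|T|%:R / 2) ^+ k.+1 * #|T|%:R
       * dot (ones rat T)
           (path_vector (@tournament_kernel T) (fun i => x (inord i)) k.+1).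
Proof.
move=> T0; set X := fun i : nat => _.
pose B i (a b : T) : rat := (1 + signed (X i) (@tournament_kernel T) b a) / 2.
rewrite -mulrA -sum_dot//.
have -> : \sum_i ones rat T i * path_vector (@tournament_kernel T) X k.+1 i
    = \sum_i path_vector (@tournament_kernel T) X k.+1 i * 1.
  by apply: eq_bigr => i _; rewrite ffunE mulrC.
rewrite mulr_sumr; under eq_bigr do rewrite mulrA -walk_half_signed//.
rewrite -(sum_paths _ _ (fun=> 1)) -sum1_card natr_sum big_mkcond /=.
apply: ler_sum => g _; rewrite mulr1.
have B01 i a b : 0 <= B i a b.
  rewrite /B; have := (signed_skew (X i) (tournament_kernel_skew T)).2 b a; lra.
case: ifP => [|_]; last by apply: prodr_ge0 => i _; exact: B01.
rewrite inE => /forallP hg; rewrite big1// => i _.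
suff -> : signed (X i) (@tournament_kernel T) (g (lift ord0 i))
    (g (widen_ord (leqnSn k.+1) i)) = 1 by [].
apply: signed_kernel_edge; rewrite /X inord_val.
set u := widen_ord _ i; set v := lift ord0 i.
have /forallP/(_ v)/implyP huv := hg u; have /forallP/(_ u)/implyP hvu := hg v.
case E : (x i); [apply: huv | apply: hvu]; apply/existsP; exists i; rewrite E /=;
  by rewrite /bump /= add1n !eqxx.
Qed.

Lemma card_edges_path_le k (x : {ffun 'I_k -> bool}) : (#|edges (path_graph x)| <= k)%N.
Proof.
pose e (i : 'I_k) : 'I_k.+1 * 'I_k.+1 :=
  let u := widen_ord (leqnSn k) i in let v := lift ord0 i in
  if x i then (u, v) else (v, u).
rewrite -[leqRHS]card_ord -cardsT; apply: leq_trans (leq_imset_card e _).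
apply: subset_leq_card; apply/fintype.subsetP => -[u v]; rewrite inE /= => /existsP[i].
move=> h; apply/imsetP; exists i => //; rewrite /e.
by case: (x i) h => /andP[/eqP hu /eqP hv]; congr pair; apply/val_inj;
   rewrite /= /bump ?add1n.
Qed.

Lemma changes_le_flips k (x : {ffun 'I_k.+1 -> bool}) :
  (changes (fun i => x (inord i)) k <= #|flips x|)%N.
Proof.
set X := fun i : nat => _; rewrite /changes.
have -> : (\sum_(i < k) (X i != X i.+1) = #|[set i : 'I_k | X i != X i.+1]|)%N.
  rewrite -sum1_card big_mkcond [RHS]big_mkcond; apply: eq_bigr => i _.
  by rewrite inE; case: eqP.
pose s (i : 'I_k) : 'I_k.+2 := inord i.+1.
have sE (i : 'I_k) : s i = i.+1 :> nat by rewrite inordK// !ltnS ltnW.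
rewrite -(card_imset _ (_ : injective s)); last first.
  by move=> i j /(congr1 val) /=; rewrite !sE => -[] /val_inj.
apply: subset_leq_card; apply/fintype.subsetP => _ /imsetP[i + ->].
rewrite !inE => Xi; apply/existsP; exists (inord i); apply/existsP; exists (inord i.+1).
have ik := ltn_ord i.
by rewrite Xi sE !inordK ?eqxx// ltnS ltnW.
Qed.

Lemma path_anti_sidorenko k (x : {ffun 'I_k -> bool}) :
  (249 * #|flips x| + 12 <= k)%N -> anti_sidorenko (path_graph x).
Proof.
case: k x => [|k] x; first by rewrite addnC.
move=> hk T [T0 _].
apply: (@le_trans _ _ ((1 / 2) ^+ k.+1)); last first.
  by apply: ler_wiXn2l => //; exact: card_edges_path_le.
rewrite /hom_density /= card_ord ler_pdivrMr ?ltr0n ?expn_gt0 ?T0//.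
apply: le_trans (card_homs_path_le x T0) _.
rewrite expr_div_n natrX.
have hm : (249 * changes (fun i => x (inord i)) k + 12 <= k.+1)%N.
  apply: leq_trans hk; rewrite leq_add2r leq_mul2l; exact: changes_le_flips.
have m1 := mean_path_vector_le1 T0 (tournament_kernel_skew T) hm.
set m := dot _ _ in m1 *.
apply: (@le_trans _ _ (#|T|%:R ^+ k.+1 / 2 ^+ k.+1 * #|T|%:R)).
  by apply: ler_piMr => //; rewrite mulr_ge0 ?divr_ge0 ?exprn_ge0 ?ler0n.
by rewrite expr_div_n expr1n le_eqVlt (exprSr _ k.+1); apply/orP; left; apply/eqP; ring.
Qed.

Lemma f_ge k m : (m <= k)%N -> few_flips_anti_sidorenko k m -> (m <= f k)%N.
Proof.
rewrite -ltnS => mk hm.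
apply: (@leq_bigmax_cond _ (fun m : 'I_k.+1 => `[< few_flips_anti_sidorenko k m >])
  (fun m => m) (Ordinal mk)).
exact/asboolP.
Qed.

Lemma f_lower_bound k : (12 <= k)%N -> (1 + (k - 12) %/ 249 <= f k)%N.
Proof.
move=> hk; apply: f_ge; first by lia.
by move=> x hx; apply: path_anti_sidorenko; lia.
Qed.

Lemma limn_einf_ge (R : realType) (u : (\bar R)^nat) (a : \bar R) N :
  (forall k, (N <= k)%N -> (a <= u k)%E) -> (a <= limn_einf u)%E.
Proof.
move=> h; rewrite limn_einf_lim.
apply: lime_ge; first exact: is_cvg_einfs.
exists N => // k /= Nk; apply: le_ereal_inf_tmp => _ [j /= kj <-].
by apply: h; apply: leq_trans kj.
Qed.

Theorem corollary1p4 (R : realType) :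
  (forall k : nat, 1454 <= k -> 1 + (k - 1454) %/ 1665 <= f k)%N /\
  ((1665%:R^-1 : R)%:E <= limn_einf (fun k : nat => ((f k)%:R / k%:R : R)%:E))%E.
Proof.
split=> [k hk|].
  by apply: leq_trans (f_lower_bound _); lia.
apply: (@limn_einf_ge _ _ _ 12) => k hk.
have kf : (k <= 1665 * f k)%N by have := f_lower_bound hk; lia.
rewrite lee_fin ler_pdivlMr ?ltr0n; last by lia.
by rewrite mulrC ler_pdivrMr ?ltr0n// mulrC -natrM ler_nat.
Qed.
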